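(* There is $n_0$ such that for all even $n\ge n_0$ and all integers $d\ge n/2$, every $d$-regular graph $G$ on $n$ vertices satisfies $$M(G)\le\Big(\big(1+n^{-1/2}\big)\frac{d}{e^2}\Big)^{dn/2},$$ where $M(G)$ denotes the number of 1-factorizations of $G$.
   Context: A 1-factorization of a $d$-regular graph $G$ is an ordered $d$-tuple of pairwise edge-disjoint perfect matchings of $G$ whose union is $E(G)$ (equivalently, a proper edge-colouring of $G$ with colour set $[d]$). $e$ denotes Euler's number. *)

(* Defs.v *)
From mathcomp Require Import all_boot.
From Stdlib Require Import Reals.
Set Implicit Arguments. Unset Strict Implicit. Unset Printing Implicit Defensive.

Definition simple_graph (n : nat) (g : rel 'I_n) : Prop :=
  (forall x, ~~ g x x) /\ (forall x y, g x y = g y x).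

Definition edges (n : nat) (g : rel 'I_n) : {set {set 'I_n}} :=
  [set e : {set 'I_n} | [exists x, exists y, g x y && (e == [set x; y])]].

Definition deg (n : nat) (g : rel 'I_n) (x : 'I_n) : nat := #|[set y | g x y]|.

Definition regular (n d : nat) (g : rel 'I_n) : Prop :=
  forall x, deg g x = d.

Definition perfect_matching (n : nat) (g : rel 'I_n) (M : {set {set 'I_n}}) : bool :=
  (M \subset edges g) && [forall x, #|[set e in M | x \in e]| == 1].

Definition one_factorization (n d : nat) (g : rel 'I_n)
    (F : {ffun 'I_d -> {set {set 'I_n}}}) : bool :=
  [forall i, perfect_matching g (F i)] &&
  [forall i, forall j, (i != j) ==> [disjoint F i & F j]] &&
  (\bigcup_(i < d) F i == edges g).

Definition num_one_factorizations (n d : nat) (g : rel 'I_n) : nat :=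
  #|[set F : {ffun 'I_d -> {set {set 'I_n}}} | one_factorization g F]|.

(* Main.v *)
Require Import Defs.
From mathcomp Require Import all_boot.
From Stdlib Require Import Reals.
From HB Require Import structures.
From mathcomp Require Import all_fingroup.
From Stdlib Require Import Lra.
Set Implicit Arguments. Unset Strict Implicit. Unset Printing Implicit Defensive.

(** By Bregman's theorem a [d]-regular graph has at most [(d!)^(n/(2d))] perfect matchings:
    the union of two perfect matchings is a disjoint union of even cycles and double edges,
    and orienting each cycle canonically turns pairs of perfect matchings injectively into
    permutations counted by the permanent of the adjacency matrix.  Deleting the matchings of
    a 1-factorization one at a time keeps the graph regular, so the number of
    1-factorizations is at most [prod_(k <= d) (k!)^(n/(2k))].  By Stirling the logarithm
    of this bound is [n/2 * (d ln d - 2 d + O(ln^2 d))], and [O(ln^2 d)] is absorbed by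
    [d ln (1 + n^(-1/2))], which is of order [sqrt n]. *)

(** * Real-valued sums, logarithm bounds and an entropy inequality *)

HB.instance Definition _ := Monoid.isComLaw.Build R 0%R Rplus
  (fun x y z => esym (Rplus_assoc x y z)) Rplus_comm Rplus_0_l.

Notation "\sum_ ( i | P ) F" := (\big[Rplus/0%R]_(i | P%B) F%R) : R_scope.
Notation "\sum_ i F" := (\big[Rplus/0%R]_i F%R) : R_scope.

Local Open Scope R_scope.

Section RealSums.
Variables (I : finType) (P : pred I).
Implicit Types F G : I -> R.

Lemma rsum_le F G :
  (forall i, P i -> F i <= G i) -> \sum_(i | P i) F i <= \sum_(i | P i) G i.
Proof.
move=> FG; elim/big_ind2: _ => [|x1 x2 y1 y2 Hx Hy|//]; first exact: Rle_refl.
exact: Rplus_le_compat.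
Qed.

Lemma rsumZ (c : R) F : c * \sum_(i | P i) F i = \sum_(i | P i) (c * F i).
Proof.
by apply: (big_morph (Rmult c)) => [x y|]; [exact: Rmult_plus_distr_l | exact: Rmult_0_r].
Qed.

Lemma rsum_const (c : R) : \sum_(i | P i) c = INR #|P| * c.
Proof.
rewrite big_const; elim: #|_| => [|k IH]; first by rewrite /= Rmult_0_l.
rewrite iterS IH S_INR; ring.
Qed.

Lemma INR_sum (f : I -> nat) :
  INR (\sum_(i | P i) f i) = \sum_(i | P i) INR (f i).
Proof. by apply: (big_morph INR) => [x y|//]; rewrite plus_INR. Qed.

End RealSums.

Lemma ln_le_sub1 x : 0 < x -> ln x <= x - 1.
Proof.
move=> x0; have := exp_ineq1_le (ln x); rewrite exp_ln //; lra.
Qed.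

Lemma INR_gt0 k : (0 < k)%nat -> 0 < INR k.
Proof. by move/ltP; apply: lt_0_INR. Qed.

Lemma INR_leq m k : (m <= k)%nat -> INR m <= INR k.
Proof. by move/leP; apply: le_INR. Qed.

Lemma ln_le_mono x y : 0 < x -> x <= y -> ln x <= ln y.
Proof.
move=> x0 [xy|->]; last exact: Rle_refl.
exact/Rlt_le/ln_increasing.
Qed.

Lemma exp_le x y : x <= y -> exp x <= exp y.
Proof. by move=> [xy|->]; [exact/Rlt_le/exp_increasing | exact: Rle_refl]. Qed.

Lemma ln_INR_leq m k : (0 < m)%nat -> (m <= k)%nat -> ln (INR m) <= ln (INR k).
Proof. by move=> m0 mk; apply: ln_le_mono; [exact: INR_gt0 | exact: INR_leq]. Qed.

(** Jensen's inequality for the convex function [t ln t]: its tangent at the mean [q] gives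
    [t ln t >= t ln q + t - q], and the linear corrections cancel on summation. A zero total is
    treated apart, since then [ln q] carries no meaning. *)
Lemma entropy_le (I : finType) (P : pred I) (t : I -> nat) (T := (\sum_(i | P i) t i)%nat) :
  INR T * ln (INR T)
    <= INR T * ln (INR #|P|) + \sum_(i | P i) (INR (t i) * ln (INR (t i))).
Proof.
have [T0|Tgt0] := posnP T.
  rewrite T0 /= !Rmult_0_l Rplus_0_l.
  have t0 i : P i -> t i = 0%nat.
    by move=> Pi; move/eqP: T0; rewrite sum_nat_eq0 => /forall_inP/(_ i Pi)/eqP.
  rewrite big1 => [|i /t0 ->]; [exact: Rle_refl | exact: Rmult_0_l].
have r0 : (0 < #|P|)%nat.
  rewrite lt0n; apply/negP => /eqP/card0_eq P0.
  by move: Tgt0; rewrite /T big_pred0 // => i; rewrite -(P0 i).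
have T0 := INR_gt0 Tgt0; have R0 := INR_gt0 r0.
set q := INR T / INR #|P|.
have q0 : 0 < q by apply: Rdiv_lt_0_compat.
have termwise i : P i -> INR (t i) * ln q + INR (t i) <= INR (t i) * ln (INR (t i)) + q.
  move=> _; have [->|ti0] := posnP (t i); first by rewrite /=; lra.
  have ti := INR_gt0 ti0.
  have qt : 0 < q / INR (t i) by apply: Rdiv_lt_0_compat.
  have lq : ln q = ln (INR (t i)) + ln (q / INR (t i)).
    by rewrite -ln_mult //; congr ln; field; lra.
  have := Rmult_le_compat_l _ _ _ (Rlt_le _ _ ti) (ln_le_sub1 qt).
  have -> : INR (t i) * (q / INR (t i) - 1) = q - INR (t i) by field; lra.
  rewrite lq; lra.
have := rsum_le termwise; rewrite !big_split /= rsum_const -INR_sum -/T.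
have -> : \sum_(i | P i) (INR (t i) * ln q) = INR T * ln q.
  rewrite Rmult_comm /T INR_sum rsumZ; apply: eq_bigr => i _; exact: Rmult_comm.
have -> : INR #|P| * q = INR T by rewrite /q; field; lra.
rewrite /q /Rdiv ln_mult //; last exact: Rinv_0_lt_compat.
rewrite ln_Rinv //; lra.
Qed.

(** * Bregman's theorem *)

Definition permset n (A : rel 'I_n) : {set 'S_n} := [set s : 'S_n | [forall i, A i (s i)]].

Definition minor n (A : rel 'I_n.+1) (i k : 'I_n.+1) : rel 'I_n :=
  fun a b => A (lift i a) (lift k b).

Definition rdeg n (A : rel 'I_n) (i : 'I_n) : nat := #|[pred j | A i j]|.

Lemma lift_perm_surj n (i k : 'I_n.+1) (s : 'S_n.+1) :
  s i = k -> exists s', s = lift_perm i k s'.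
Proof.
move=> sik.
have kD a : k != s (lift i a) by rewrite -sik (inj_eq perm_inj) neq_lift.
pose f a := odflt a (unlift k (s (lift i a))).
have fE a : lift k (f a) = s (lift i a).
  by rewrite /f; case: (unlift_some (kD a)) => j -> ->.
have f_inj : injective f.
  by move=> a b fab; apply: (@lift_inj _ i); apply: (@perm_inj _ s); rewrite -!fE fab.
exists (perm f_inj); apply/permP => x.
case: (unliftP i x) => [a ->|->]; first by rewrite lift_perm_lift permE fE.
by rewrite lift_perm_id.
Qed.

Lemma card_fiber_minor n (A : rel 'I_n.+1) i k :
  (#|[set s : 'S_n.+1 in permset A | s i == k]| <= #|permset (minor A i k)|)%nat.
Proof.
apply: leq_trans (leq_imset_card (lift_perm i k) _).
apply/subset_leq_card/subsetP => s; rewrite !inE => /andP[/forallP As /eqP sik].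
have [s' sE] := lift_perm_surj sik.
rewrite sE; apply: imset_f; rewrite inE; apply/forallP => a.
by have := As (lift i a); rewrite sE lift_perm_lift.
Qed.

Lemma rdegE n (A : rel 'I_n) i : rdeg A i = (\sum_j A i j)%nat.
Proof.
by rewrite /rdeg -sum1_card big_mkcond; apply: eq_bigr => j _; rewrite inE; case: (A i j).
Qed.

Lemma rdeg_minor n (A : rel 'I_n.+1) i k a :
  rdeg (minor A i k) a = (rdeg A (lift i a) - A (lift i a) k)%nat.
Proof. by rewrite !rdegE (bigD1_ord k) //= addKn. Qed.

Lemma ln_factS k : ln (INR k.+1`!) = ln (INR k.+1) + ln (INR k`!).
Proof. by rewrite factS mult_INR ln_mult //; apply: INR_gt0; rewrite ?fact_gt0. Qed.

(* The logarithm of Bregman's factor [(r!)^(1/r)]; [0] at [r = 0], since [ln 1 = 0]. *)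
Definition wt (r : nat) : R := ln (INR r`!) / INR r.

Lemma mul_wt r : (0 < r)%nat -> INR r * wt r = ln (INR r`!).
Proof. by move=> r0; rewrite /wt; field; have := INR_gt0 r0; lra. Qed.

(** Logarithm of [r! = r * (r-1)!]; at [r = 1] the factor [INR r - 1] kills the term in [wt 0]. *)
Lemma wt_pred r : (0 < r)%nat -> INR r * wt r = ln (INR r) + (INR r - 1) * wt r.-1.
Proof.
case: r => // r _; rewrite mul_wt // ln_factS S_INR /=; congr (_ + _).
have [->|r0] := posnP r; first by rewrite fact0 /= ln_1; ring.
by rewrite -(mul_wt r0); ring.
Qed.

(** Deleting column [k] lowers the degree of row [j] exactly for the [rdeg A j] columns it meets. In
    Bregman's induction a permutation [s] makes [s i] run over all columns as [i] varies. *)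
Lemma row_wt_sum n (A : rel 'I_n) j :
  \sum_k wt (rdeg A j - A j k) =
    INR (rdeg A j) * wt (rdeg A j).-1 + (INR n - INR (rdeg A j)) * wt (rdeg A j).
Proof.
rewrite (bigID (A j)) /=.
under eq_bigr => k Ajk do rewrite Ajk subn1.
under [X in _ + X]eq_bigr => k Ajk do rewrite (negbTE Ajk) subn0.
rewrite !rsum_const; congr (_ * _ + _ * _).
transitivity (INR #|predC (A j)|); first by congr INR; apply: eq_card.
have -> : INR n = INR (#|A j| + #|predC (A j)|)%nat by rewrite cardC card_ord.
by rewrite plus_INR /rdeg; have -> : #|[pred k | A j k]| = #|A j| by []; ring.
Qed.

Lemma rdeg_gt0 n (A : rel 'I_n) (s : 'S_n) i : s \in permset A -> (0 < rdeg A i)%nat.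
Proof. by rewrite inE => /forallP/(_ i) Ai; apply/card_gt0P; exists (s i). Qed.

Lemma card_fiber_ge1 n (A : rel 'I_n) (s : 'S_n) i :
  s \in permset A -> (0 < #|[set s' : 'S_n in permset A | s' i == s i]|)%nat.
Proof. by move=> sA; apply/card_gt0P; exists s; rewrite inE sA eqxx. Qed.

(* Schrijver's proof: apply [entropy_le] to the expansion of the permanent along each row,
   rewrite the resulting sums as sums over the permutations [s] themselves, and bound, for
   each fixed [s], the minors at [(i, s i)] by induction. *)
Theorem bregman n (A : rel 'I_n) : (0 < #|permset A|)%nat ->
  ln (INR #|permset A|) <= \sum_i wt (rdeg A i).
Proof.
elim: n => [|n IH] in A * => S0.
  rewrite big_ord0.
  have: (#|permset A| <= 1)%nat by rewrite (leq_trans (max_card _)) // card_Sn.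
  by case: #|_| S0 => [|[|]] //= _ _; rewrite ln_1; exact: Rle_refl.
set S := permset A in S0 *.
pose t i k := #|[set s : 'S_n.+1 in S | s i == k]|.
have row i : INR #|S| * ln (INR #|S|) <=
    \sum_(s | s \in S) (ln (INR (rdeg A i)) + ln (INR (t i (s i)))).
  have Si (s : 'S_n.+1) : s \in S -> A i (s i) by rewrite inE => /forallP.
  have tsum : (\sum_(k | A i k) t i k)%nat = #|S|.
    rewrite -sum1_card (partition_big (fun s : 'S_n.+1 => s i) (A i)) //=.
    apply: eq_bigr => k _; rewrite /t -sum1_card; by apply: eq_bigl => s; rewrite inE.
  have := entropy_le (A i) (t i); rewrite tsum => /Rle_trans; apply.
  rewrite big_split /= rsum_const; apply/Rplus_le_compat_l/Req_le.
  rewrite (partition_big (fun s : 'S_n.+1 => s i) (A i)) //=.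
  apply: eq_bigr => k _; rewrite (eq_bigr (fun=> ln (INR (t i k)))).
    rewrite rsum_const; congr (INR _ * _); apply: eq_card => s; by rewrite [LHS]inE.
  by move=> s /andP[_ /eqP ->].
have perm_bound (s : 'S_n.+1) : s \in S ->
    \sum_i (ln (INR (rdeg A i)) + ln (INR (t i (s i)))) <=
      INR n.+1 * \sum_j wt (rdeg A j).
  move=> sS; have r0 j := rdeg_gt0 j sS.
  have As j : A j (s j) by move: sS; rewrite inE => /forallP.
  (* The minor has no row [i]. Adding the term of row [i] on both sides makes the right-hand sum run
     over all rows, so that the sums over [i] and [j] can be exchanged. *)
  have fiber i : ln (INR (t i (s i))) + wt (rdeg A i).-1 <=
      \sum_j wt (rdeg A j - A j (s i)).
    have t0 := card_fiber_ge1 i sS.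
    have tm := card_fiber_minor A i (s i).
    rewrite (bigD1_ord i) //= As subn1 Rplus_comm; apply: Rplus_le_compat_l.
    apply: Rle_trans (ln_INR_leq t0 tm) _.
    under eq_bigr => a _ do rewrite -rdeg_minor.
    exact: IH (leq_trans t0 tm).
  have := rsum_le (fun i (_ : xpredT i) => fiber i).
  rewrite exchange_big /=.
  under [X in _ <= X]eq_bigr => j _.
    rewrite -(reindex_inj (h := s) (P := xpredT) (F := fun k => wt (rdeg A j - A j k))) //;
      last exact: perm_inj.
    rewrite row_wt_sum.
  over.
  move=> le_sum; rewrite rsumZ.
  (* Row by row this is [wt_pred]. *)
  suff -> : \sum_j (INR n.+1 * wt (rdeg A j)) =
      \sum_j (ln (INR (rdeg A j)) - wt (rdeg A j).-1)
      + \sum_j (INR (rdeg A j) * wt (rdeg A j).-1 +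
               (INR n.+1 - INR (rdeg A j)) * wt (rdeg A j)).
    apply: Rle_trans (Rplus_le_compat_l _ _ _ le_sum).
    rewrite -big_split /=; apply: Req_le; apply: eq_bigr => i _; ring.
  rewrite -big_split /=; apply: eq_bigr => j _.
  have := wt_pred (r0 j); lra.
have Spos := INR_gt0 S0; have npos := INR_gt0 (ltn0Sn n).
have := rsum_le (fun i (_ : xpredT i) => row i).
rewrite rsum_const card_ord exchange_big => le1.
have := Rle_trans _ _ _ le1 (rsum_le perm_bound).
rewrite rsum_const (_ : #|[pred s | s \in S]| = #|S|) // => le2.
apply: (Rmult_le_reg_l (INR n.+1 * INR #|S|)); first exact: Rmult_lt_0_compat.
rewrite !Rmult_assoc (Rmult_comm (INR #|S|) (\sum_i _)).
apply: Rle_trans le2 _; apply: Req_le; ring.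
Qed.

(** * Pairs of perfect matchings *)

Section Pairs.
Local Open Scope group_scope.
Variable T : finType.
Implicit Types (a b c s : {perm T}) (x y : T).

Definition fpf_involution a := [forall x, (a (a x) == x) && (a x != x)].

Lemma porbit_step s x y : (s y \in porbit s x) = (y \in porbit s x).
Proof.
rewrite porbit_sym -[RHS]porbit_sym -!eq_porbit_mem.
by have := porbit_perm s 1 y; rewrite expg1 => ->.
Qed.

Lemma porbit_least s x (D : {pred T}) :
  x \in D -> (forall y, y \in D -> s y \in D) -> {subset porbit s x <= D}.
Proof.
move=> Dx Ds y /porbitP[k ->]; elim: k => [|k IH]; first by rewrite expg0 perm1.
by rewrite expgSr permM Ds.
Qed.

Lemma porbit_sub_step (s t : {perm T}) x : (forall y, s y = t y \/ s (t y) = y) ->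
  {subset porbit t x <= porbit s x}.
Proof.
move=> st; apply: porbit_least => [|y yx]; first exact: porbit_id.
by case: (st y) => [<-|sty]; [rewrite porbit_step | rewrite -porbit_step sty].
Qed.

(** A point chosen from [D] alone when [D] is nonempty; [x] is only the default. This independence
    of [x] makes the orientation of each cycle canonical. *)
Definition rep (D : {set T}) x := odflt x [pick y in D].

Lemma rep_in (D : {set T}) x : x \in D -> rep D x \in D.
Proof. by rewrite /rep; case: pickP => //= D0; rewrite D0. Qed.

Lemma rep_indep (D : {set T}) x y : x \in D -> rep D x = rep D y.
Proof. by rewrite /rep; case: pickP => //= D0; rewrite D0. Qed.

(* [a] and [b] encode two perfect matchings; the components of their union are the orbits
   of the dihedral group they generate, and each of these is the disjoint union of two
   orbits of the rotation [a * b], exchanged by [a] and by [b]. *)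
Definition component a b x : {set T} := porbit (a * b) x :|: porbit (a * b) (a x).

Definition even_side a b x : bool := rep (component a b x) x \in porbit (a * b) x.

(** Leaving one side along [a] and the other along [b] runs around each alternating cycle in one
    direction; [rep] decides which. *)
Definition follow a b x : T := if even_side a b x then a x else b x.

Section OnePair.
Variables a b : {perm T}.
Hypotheses (inv_a : fpf_involution a) (inv_b : fpf_involution b).
Let r := a * b.

Let aK x : a (a x) = x. Proof. by have /forallP/(_ x)/andP[/eqP] := inv_a. Qed.
Let bK x : b (b x) = x. Proof. by have /forallP/(_ x)/andP[/eqP] := inv_b. Qed.
Let a_neq x : a x != x. Proof. by have /forallP/(_ x)/andP[] := inv_a. Qed.
Let b_neq x : b x != x. Proof. by have /forallP/(_ x)/andP[] := inv_b. Qed.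

(** Conjugation by [a] inverts [r], and a permutation has the same orbits as its inverse. *)
Lemma rotation_swap x y : (a y \in porbit r (a x)) = (y \in porbit r x).
Proof.
have H u v : v \in porbit r u -> a v \in porbit r (a u).
  apply: (@porbit_least r u [pred v | a v \in porbit r (a u)]) => [|{}v].
    by rewrite inE porbit_id.
  by rewrite !inE -(porbit_step r _ (a (r v))) /r !permM !aK bK.
by apply/idP/idP => [/H|/H //]; rewrite !aK.
Qed.

Lemma rotation_swapb x y : (b y \in porbit r x) = (a y \in porbit r x).
Proof. by rewrite -[in RHS]porbit_step /r permM aK. Qed.

(** If [a x = r^k x], then [a (r x) = r^(k-2) (r x)]. Descending by two ends at [k = 0], a fixed
    point of [a], or at [k = 1], a fixed point of [b]. *)
Lemma involution_notin_porbit x : a x \notin porbit r x.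
Proof.
apply/negP => /porbitP[k].
elim/ltn_ind: k x => -[|[|k]] IH x.
- by rewrite expg0 perm1 => /eqP; rewrite (negbTE (a_neq x)).
- by rewrite expg1 /r permM => /esym/eqP; rewrite (negbTE (b_neq _)).
move=> ax; apply: (IH k _ (r x)) => //.
apply: (@perm_inj _ r); move: ax; rewrite expgS permM expgSr permM => <-.
by rewrite /r !permM aK bK.
Qed.

Lemma mem_component_a x y : (a y \in component a b x) = (y \in component a b x).
Proof. by rewrite !inE rotation_swap orbC -{2}[x]aK rotation_swap. Qed.

Lemma component_a x : component a b (a x) = component a b x.
Proof. by rewrite /component aK setUC. Qed.

Lemma porbit_b x : porbit r (b x) = porbit r (a x).
Proof. by apply/eqP; rewrite eq_porbit_mem rotation_swapb porbit_id. Qed.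

Lemma porbit_ab x : porbit r (a (b x)) = porbit r x.
Proof.
apply/eqP; rewrite eq_porbit_mem -[X in _ \in porbit _ X]aK.
by rewrite rotation_swap rotation_swapb porbit_id.
Qed.

Lemma component_b x : component a b (b x) = component a b x.
Proof. by rewrite /component porbit_ab porbit_b setUC. Qed.

Lemma component_id x : x \in component a b x.
Proof. by rewrite inE porbit_id. Qed.

Lemma even_sideN x y : porbit r y = porbit r (a x) -> component a b y = component a b x ->
  even_side a b y = ~~ even_side a b x.
Proof.
rewrite /even_side -/r => -> ->.
have cx := rep_in (component_id x).
rewrite -(rep_indep y (component_id x)).
case: (boolP (_ \in porbit r x)) => [m1|m1]; last by move: cx; rewrite inE (negbTE m1).
apply/negbTE/negP; rewrite -!eq_porbit_mem in m1 *; rewrite (eqP m1) => xax.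
by have := involution_notin_porbit x; rewrite -eq_porbit_mem eq_sym xax.
Qed.

Lemma even_side_a x : even_side a b (a x) = ~~ even_side a b x.
Proof. by apply: even_sideN => //; exact: component_a. Qed.

Lemma even_side_b x : even_side a b (b x) = ~~ even_side a b x.
Proof. by apply: even_sideN; [exact: porbit_b | exact: component_b]. Qed.

(** Each step changes side, so two points with the same image lie on the same side and both move by
    [a] or both by [b]. *)
Lemma follow_inj : injective (follow a b).
Proof.
move=> x y; rewrite /follow.
case: ifPn => tx; case: ifPn => ty; try exact: perm_inj.
- by move/(congr1 (even_side a b)); rewrite even_side_a even_side_b tx (negbTE ty).
by move/(congr1 (even_side a b)); rewrite even_side_a even_side_b ty (negbTE tx).
Qed.

Definition union_perm : {perm T} := perm follow_inj.

Let c := union_perm.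

Lemma union_permE x : c x = if even_side a b x then a x else b x.
Proof. by rewrite permE. Qed.

Lemma mem_component_c x y : y \in component a b x -> c y \in component a b x.
Proof.
rewrite union_permE; case: ifP => _; first by rewrite mem_component_a.
by rewrite !inE !rotation_swapb -!in_setU mem_component_a.
Qed.

(* [c * c] acts as [r] or as [r^-1], so that [c] alone determines the components and
   [even_side], hence also [a] and [b]. *)
Lemma union_perm_square x : porbit (c * c) x = porbit r x.
Proof.
have even y : even_side a b y -> (c * c) y = r y.
  by move=> ey; rewrite !permM !union_permE ey even_side_a ey.
have odd y : ~~ even_side a b y -> (c * c) y = a (b y).
  by move=> ey; rewrite permM !union_permE (negbTE ey) even_side_b ey.
apply/porbit_setP => y; apply/idP/idP; apply: porbit_sub_step => z.
  case: (boolP (even_side a b z)) => [/even ->|/odd ->]; first by left.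
  by right; rewrite /r permM aK bK.
case: (boolP (even_side a b z)) => [/even ->|ez]; first by left.
right; rewrite odd /r permM ?bK ?aK //.
by rewrite even_side_b even_side_a negbK.
Qed.

Lemma union_perm_component x : porbit c x = component a b x.
Proof.
have sub y : {subset porbit r y <= porbit c y}.
  rewrite -union_perm_square; apply: porbit_least => [|z]; first exact: porbit_id.
  by rewrite permM !porbit_step.
apply/setP => y; apply/idP/idP.
  by apply: porbit_least => [|z]; [exact: component_id | exact: mem_component_c].
rewrite inE => /orP[/sub //|].
(* One step of [c] crosses to the other rotation orbit of the component. *)
have <- : porbit r (c x) = porbit r (a x).
  by rewrite union_permE; case: ifP => _; rewrite ?porbit_b.
by move/sub; rewrite porbit_sym porbit_step porbit_sym.
Qed.

Lemma even_side_union x :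
  even_side a b x = (rep (porbit c x) x \in porbit (c * c) x).
Proof. by rewrite /even_side union_perm_component union_perm_square. Qed.

Lemma union_perm_left x : a x = if even_side a b x then c x else c^-1 x.
Proof.
case: ifPn => ex; first by rewrite union_permE ex.
by apply: (canRL (permK c)); rewrite union_permE even_side_a ex aK.
Qed.

Lemma union_perm_right x : b x = if even_side a b x then c^-1 x else c x.
Proof.
case: ifPn => ex; last by rewrite union_permE (negbTE ex).
by apply: (canRL (permK c)); rewrite union_permE even_side_b ex bK.
Qed.

End OnePair.

(** The map from [(a, b)] to [union_perm] stays inside [A], because every value is [a x] or [b x].
    It is injective because the sides, and from them [a] and [b], can be read off from the image. *)
Lemma card_fpf_involution_sq (A : rel T) (S := [set s | fpf_involution s & [forall x, A x (s x)]]) :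
  (#|S| * #|S| <= #|[set s : {perm T} | [forall x, A x (s x)]]|)%nat.
Proof.
(* [union_perm] takes the involution proofs as arguments; [pick] gives a function on all pairs that
   agrees with it on pairs of fixed-point-free involutions. *)
pose f (p : {perm T} * {perm T}) :=
  odflt 1 [pick c : {perm T} | [forall x, c x == follow p.1 p.2 x]].
have fE a b (ia : fpf_involution a) (ib : fpf_involution b) : f (a, b) = union_perm ia ib.
  rewrite /f; case: pickP => [c /forallP cE|/(_ (union_perm ia ib))/negP[]] /=.
    by apply/permP => x; rewrite (eqP (cE x)) permE.
  by apply/forallP => x; rewrite permE.
rewrite -cardsX -(@card_in_imset _ _ f).
  apply/subset_leq_card/subsetP => _ /imsetP[[a b]] + ->.
  rewrite !inE => /andP[/andP[ia /forallP Aa] /andP[ib /forallP Ab]].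
  by apply/forallP => x; rewrite fE union_permE; case: ifP.
move=> [a b] [a' b']; rewrite !inE.
move=> /andP[/andP[ia _] /andP[ib _]] /andP[/andP[ia' _] /andP[ib' _]].
rewrite !fE => cc'.
by congr (_, _); apply/permP => x;
  rewrite ?(union_perm_left ia ib) ?(union_perm_left ia' ib') ?(union_perm_right ia ib)
   ?(union_perm_right ia' ib') !even_side_union cc'.
Qed.

End Pairs.

(** * Matchings and 1-factorizations *)

Section Matchings.
Variable n : nat.
Implicit Types (g : rel 'I_n) (M : {set {set 'I_n}}) (x y z : 'I_n).

Lemma edgesP g e :
  reflect (exists x y, g x y /\ e = [set x; y]) (e \in edges g).
Proof.
rewrite inE; apply: (iffP existsP) => [[x /existsP[y /andP[gxy /eqP ->]]]|[x [y [gxy ->]]]].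
  by exists x, y.
by exists x; apply/existsP; exists y; rewrite gxy eqxx.
Qed.

Lemma simple_neq g x y : simple_graph g -> g x y -> y != x.
Proof. by case=> irr _ gxy; apply: contraTneq gxy => ->. Qed.

Lemma set2_injr x y z : y != x -> [set x; y] = [set x; z] -> y = z.
Proof.
move=> yx /setP/(_ y); rewrite !inE eqxx orbT (negbTE yx) /=.
by move/esym/eqP.
Qed.

Lemma edges_set2 g x y : simple_graph g -> ([set x; y] \in edges g) = g x y.
Proof.
move=> sg; apply/edgesP/idP => [[u [v [guv E]]]|gxy]; last by exists x, y.
have vu := simple_neq sg guv; have [irr sym] := sg.
have: x \in [set u; v] by rewrite -E set21.
rewrite !inE => /orP[]/eqP xE.
  have -> : y = v by apply/esym/(set2_injr vu); rewrite -E xE.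
  by rewrite xE.
have -> : y = u.
  by apply/esym/(@set2_injr v); [rewrite eq_sym | rewrite setUC -E xE].
by rewrite xE sym.
Qed.

Lemma matched_ex g M x : simple_graph g -> perfect_matching g M ->
  exists y, [set x; y] \in M.
Proof.
move=> sg /andP[/subsetP Mg /forallP/(_ x)/cards1P[e E]].
have : e \in [set e0 in M | x \in e0] by rewrite E set11.
rewrite inE => /andP[eM]; have /edgesP[u [v [_ eE]]] := Mg e eM.
rewrite eE in eM *; rewrite !inE => /orP[]/eqP ->; first by exists v.
by exists u; rewrite setUC.
Qed.

Lemma matching_adj g M x y : simple_graph g -> perfect_matching g M ->
  [set x; y] \in M -> g x y.
Proof. by move=> sg /andP[/subsetP Mg _] /Mg; rewrite edges_set2. Qed.

Lemma matched_uniq g M x y z : simple_graph g -> perfect_matching g M ->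
  [set x; y] \in M -> [set x; z] \in M -> y = z.
Proof.
move=> sg pm xy xz; have yx := simple_neq sg (matching_adj sg pm xy).
apply: (set2_injr yx); move: pm => /andP[_ /forallP/(_ x)/cards1P[e E]].
have in_e u : [set x; u] \in M -> [set x; u] = e.
  by move=> xu; apply/set1P; rewrite -E inE xu set21.
by rewrite (in_e _ xy) (in_e _ xz).
Qed.

Definition partner M x : 'I_n := odflt x [pick y | [set x; y] \in M].

Lemma partner_in g M x : simple_graph g -> perfect_matching g M ->
  [set x; partner M x] \in M.
Proof.
move=> sg pm; rewrite /partner; case: pickP => //= none.
by have [y xy] := matched_ex x sg pm; have := none y; rewrite /= xy.
Qed.

Lemma partnerK g M : simple_graph g -> perfect_matching g M -> involutive (partner M).
Proof.
move=> sg pm x; apply: (matched_uniq sg pm (partner_in _ sg pm)).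
by rewrite setUC (partner_in _ sg pm).
Qed.

Lemma matchingE g M : simple_graph g -> perfect_matching g M ->
  M = [set [set x; partner M x] | x : 'I_n].
Proof.
move=> sg pm; apply/setP => e; apply/idP/imsetP => [eM|[x _ ->]]; last by apply: partner_in pm.
have /andP[/subsetP/(_ e eM)/edgesP[x [y [_ eE]]] _] := pm.
exists x => //; rewrite eE; congr [set _; _].
by apply: (matched_uniq sg pm _ (partner_in x sg pm)); rewrite -eE.
Qed.

(** * Counting the perfect matchings of a regular graph *)

Definition matchings g : {set {set {set 'I_n}}} := [set M | perfect_matching g M].

(** A matching is encoded by its partner map and recovered from it by [matchingE]. *)
Lemma card_matchings_le g : simple_graph g ->
  (#|matchings g| <=
     #|[set s : 'S_n | fpf_involution s & [forall x, g x (s x)]]|)%nat.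
Proof.
move=> sg.
pose f M : 'S_n := odflt 1%g [pick s : 'S_n | [forall x, s x == partner M x]].
have fE M x : perfect_matching g M -> f M x = partner M x.
  move=> pm; rewrite /f; case: pickP => [s /forallP/(_ x)/eqP //|none].
  have := none (perm (inv_inj (partnerK sg pm))).
  by move/negP; case; apply/forallP => y; rewrite permE.
rewrite -(@card_in_imset _ _ f).
  apply/subset_leq_card/subsetP => _ /imsetP[M Mg ->].
  have pm : perfect_matching g M by rewrite inE in Mg.
  have adj x := matching_adj sg pm (partner_in x sg pm).
  rewrite inE; apply/andP; split; apply/forallP => x; rewrite !fE //.
  by rewrite (partnerK sg pm) eqxx (simple_neq sg).
move=> M N; rewrite !inE => pM pN MN.
rewrite (matchingE sg pM) (matchingE sg pN); apply: eq_imset => x.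
by rewrite -!fE // MN.
Qed.

(** The square of the number of matchings is at most the permanent of the adjacency matrix, which
    Bregman bounds by [exp (n * wt d)]; taking the root halves the exponent. *)
Lemma card_matchings_regular g d : simple_graph g -> regular d g ->
  INR #|matchings g| <= exp (INR n / 2 * wt d).
Proof.
move=> sg rg; have [->|m0] := posnP #|matchings g|; first exact/Rlt_le/exp_pos.
have le_sq := leq_trans (leq_mul (card_matchings_le sg) (card_matchings_le sg))
  (card_fpf_involution_sq g).
have S0 : (0 < #|permset g|)%nat by apply: leq_trans le_sq; rewrite muln_gt0 m0.
have := Rle_trans _ _ _ (ln_INR_leq _ le_sq) (bregman S0).
rewrite muln_gt0 m0 => /(_ isT).
rewrite (eq_bigr (fun=> wt d)) => [|i _]; last first.
  by rewrite -(rg i) /deg /rdeg cardsE.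
rewrite rsum_const card_ord mult_INR; have mpos := INR_gt0 m0.
rewrite ln_mult // => le_ln.
rewrite -[X in X <= _](exp_ln _ mpos).
apply: exp_le; lra.
Qed.

(** * Removing the matchings of a 1-factorization one at a time *)

Definition delete_matching g M : rel 'I_n :=
  fun x y => g x y && ([set x; y] \notin M).

Lemma simple_delete g M : simple_graph g -> simple_graph (delete_matching g M).
Proof.
case=> irr sym; split=> [x|x y]; rewrite /delete_matching.
  by rewrite (negbTE (irr x)).
by rewrite sym [in RHS]setUC.
Qed.

Lemma regular_delete g M d : simple_graph g -> perfect_matching g M ->
  regular d.+1 g -> regular d (delete_matching g M).
Proof.
move=> sg pm rg x; apply/eqP; rewrite -eqSS -(rg x) /deg.
rewrite [X in _ == X](cardsD1 (partner M x)) inE.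
rewrite (matching_adj sg pm (partner_in x sg pm)) add1n eqSS; apply/eqP/eq_card => y.
rewrite !inE andbC /delete_matching; congr (_ && _); congr (~~ _).
apply/idP/eqP => [xy|->]; last exact: partner_in sg pm.
exact: matched_uniq sg pm xy (partner_in x sg pm).
Qed.

Lemma edges_delete g M : edges (delete_matching g M) = edges g :\: M.
Proof.
apply/setP => e; rewrite in_setD; apply/edgesP/andP.
  by case=> x [y [/andP[gxy xyM] ->]]; split=> //; apply/edgesP; exists x, y.
case=> eM /edgesP[x [y [gxy eE]]]; exists x, y.
by rewrite /delete_matching gxy -eE.
Qed.

Lemma one_factorization_delete d g (F : {ffun 'I_d.+1 -> {set {set 'I_n}}}) :
  one_factorization g F ->
  one_factorization (delete_matching g (F ord0)) [ffun i => F (lift ord0 i)].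
Proof.
case/andP=> /andP[/forallP pm /forallP disj] /eqP cover.
have {}disj i j : i != j -> [disjoint F i & F j].
  by have /forallP/(_ j)/implyP := disj i.
apply/andP; split; [apply/andP; split|].
- apply/forallP => i; rewrite ffunE; have /andP[sub one] := pm (lift ord0 i).
  by rewrite /perfect_matching one edges_delete subsetD sub disj.
- apply/forallP => i; apply/forallP => j; apply/implyP => ij.
  by rewrite !ffunE disj // (inj_eq lift_inj).
rewrite edges_delete -cover big_ord_recl setDUl setDv set0U.
under eq_bigr => i _ do rewrite ffunE.
apply/eqP/esym/setDidPl; rewrite disjoint_sym; apply: bigcup_disjoint => i _.
exact: disj.
Qed.

(** Sort the 1-factorizations by their first matching; the remaining ones factorize what is left of
    the graph. *)
Lemma num_one_factorizations_rec d g :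
  (num_one_factorizations d.+1 g <=
     \sum_(M in matchings g) num_one_factorizations d (delete_matching g M))%nat.
Proof.
rewrite /num_one_factorizations -sum1_card.
rewrite (partition_big (fun F : {ffun _ -> _} => F ord0) (mem (matchings g))) /=.
  apply: leq_sum => M _; rewrite sum1_card.
  pose f (F : {ffun 'I_d.+1 -> {set {set 'I_n}}}) := [ffun i => F (lift ord0 i)].
  rewrite -(@card_in_imset _ _ f).
    apply/subset_leq_card/subsetP => _ /imsetP[F /andP[+ /eqP <-] ->].
    rewrite !inE; exact: one_factorization_delete.
  move=> F G /andP[_ /eqP F0] /andP[_ /eqP G0] /ffunP FG.
  apply/ffunP => i; case: (unliftP ord0 i) => [j ->|->]; last by rewrite F0 G0.
  by have := FG j; rewrite !ffunE.
by move=> F; rewrite !inE => /andP[/andP[/forallP]].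
Qed.

Lemma num_one_factorizations_le d g : simple_graph g -> regular d g ->
  INR (num_one_factorizations d g) <= exp (INR n / 2 * \big[Rplus/0]_(k < d) wt k.+1).
Proof.
elim: d g => [|d IH] g sg rg.
  rewrite big_ord0 Rmult_0_r exp_0 -INR_1; apply: INR_leq.
  by rewrite (leq_trans (max_card _)) // card_ffun card_ord expn0.
apply: Rle_trans (INR_leq (num_one_factorizations_rec d g)) _.
(* The last summand, [wt d.+1], pays for the matching removed first, while the graph is still
   [d.+1]-regular. *)
rewrite INR_sum big_ord_recr /= Rmult_plus_distr_l Rplus_comm exp_plus.
apply: Rle_trans (Rmult_le_compat_r _ _ _ (Rlt_le _ _ (exp_pos _)) (card_matchings_regular sg rg)).
rewrite -(@rsum_const _ (mem (matchings g))); apply: rsum_le => M; rewrite !inE => pm.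
by apply: IH; [exact: simple_delete | exact: regular_delete].
Qed.

End Matchings.

(** * Asymptotics *)

Lemma ln_ge_sub_inv x : 0 < x -> 1 - / x <= ln x.
Proof.
move=> x0; have := ln_le_sub1 (Rinv_0_lt_compat _ x0); rewrite ln_Rinv //; lra.
Qed.

(** This drives both the Stirling bound and the harmonic sum below. *)
Lemma inv_succ_le_ln k : (0 < k)%nat -> / INR k.+1 <= ln (INR k.+1) - ln (INR k).
Proof.
move=> k0; have kp := INR_gt0 k0; have kS : 0 < INR k.+1 by apply: INR_gt0.
have q0 : 0 < INR k.+1 / INR k by apply: Rdiv_lt_0_compat.
have -> : ln (INR k.+1) - ln (INR k) = ln (INR k.+1 / INR k).
  rewrite /Rdiv ln_mult //; last exact: Rinv_0_lt_compat.
  by rewrite ln_Rinv //; ring.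
apply: Rle_trans (ln_ge_sub_inv q0); apply: Req_le.
by move: kS; rewrite S_INR => kS; field; lra.
Qed.

(** Stirling in the form [k! <= e k (k/e)^k]; the induction step amounts to
    [(k+1) (ln (k+1) - ln k) >= 1]. *)
Lemma ln_fact_le k : (0 < k)%nat ->
  ln (INR k`!) <= INR k * ln (INR k) - INR k + (1 + ln (INR k)).
Proof.
case: k => // k _; elim: k => [|k IH]; first by rewrite /= ln_1; lra.
rewrite ln_factS; have kS : 0 < INR k.+2 by apply: INR_gt0.
have := Rmult_le_compat_l _ _ _ (Rlt_le _ _ kS) (inv_succ_le_ln (ltn0Sn k)).
rewrite Rinv_r; last lra.
move: IH; rewrite (S_INR k.+1); lra.
Qed.

Lemma wt_le k : (0 < k)%nat -> wt k <= ln (INR k) - 1 + (1 + ln (INR k)) / INR k.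
Proof.
move=> k0; have kp := INR_gt0 k0.
apply: (Rmult_le_reg_l (INR k)) => //; rewrite mul_wt //.
apply: Rle_trans (ln_fact_le k0) _; apply: Req_le; field; lra.
Qed.

Lemma ln_INR_ge0 k : (0 < k)%nat -> 0 <= ln (INR k).
Proof. by move=> k0; rewrite -ln_1; apply: ln_INR_leq (leqnn 1) k0. Qed.

(** In [wt_le] the main terms [ln k - 1] add up to [ln d! - d], to which Stirling applies once more.
    The errors are at most [L / k], and the harmonic sum [1 + ln d = L] turns them into [L * L]. *)
Lemma wt_sum_le d (L := 1 + ln (INR d)) : (0 < d)%nat ->
  \big[Rplus/0]_(k < d) wt k.+1 <= INR d * ln (INR d) - 2 * INR d + L + L * L.
Proof.
move=> d0; have L1 := ln_INR_ge0 d0.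
suff partial m : (m.+1 <= d)%nat ->
    \big[Rplus/0]_(k < m.+1) wt k.+1 <=
      ln (INR m.+1`!) - INR m.+1 + L * (1 + ln (INR m.+1)).
  case: d d0 @L L1 partial => // d d0 L L1 /(_ d (leqnn _)).
  by have := ln_fact_le d0; rewrite -/L; lra.
elim: m => [|m IH] md.
  rewrite big_ord_recr big_ord0 /wt /= ln_1 /L; lra.
rewrite big_ord_recr; apply: Rle_trans (Rplus_le_compat_r _ _ _ (IH (ltnW md))) _.
have Lm : ln (INR m.+2) <= ln (INR d) by apply: ln_INR_leq.
have mp : 0 < INR m.+2 by apply: INR_gt0.
have inv0 : 0 <= / INR m.+2 by apply/Rlt_le/Rinv_0_lt_compat.
have := wt_le (ltn0Sn m.+1).
have le1 : (1 + ln (INR m.+2)) / INR m.+2 <= L * / INR m.+2.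
  by apply: Rmult_le_compat_r => //; rewrite /L; lra.
have le2 : L * / INR m.+2 <= L * (ln (INR m.+2) - ln (INR m.+1)).
  by apply: Rmult_le_compat_l; [rewrite /L; lra | exact: inv_succ_le_ln].
have := ln_factS m.+1; have := S_INR m.+1; rewrite [X in _ + wt X]/=; lra.
Qed.

(* With [y = N^(1/8)], the left side is at most [8 y + 64 y^2 <= 72 y^2], the right side at
   least [sqrt N / 4 = y^4 / 4]; hence the constant [288 = 4 * 72]. *)
Lemma error_term_le (N D : R) (L := 1 + ln D) :
  exp (4 * ln 288) <= N -> 1 <= D -> N / 2 <= D <= N ->
  L + L * L <= D * ln (1 + Rpower N (- (1 / 2))).
Proof.
move=> N_large D1 [ND DN].
have N0 : 0 < N by have := exp_pos (4 * ln 288); lra.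
pose y := exp (ln N / 8).
have y0 : 0 < y by apply: exp_pos.
(* The threshold on [N] is [288^4], and [y * y] is the fourth root of [N]. *)
have y_large : 288 <= y * y.
  have le : 4 * ln 288 <= ln N.
    by rewrite -(ln_exp (4 * ln 288)); apply: ln_le_mono => //; apply: exp_pos.
  rewrite /y -exp_plus -[X in X <= _](exp_ln 288); last lra.
  by apply: exp_le; lra.
have yE : y * y * (y * y) * Rpower N (- (1 / 2)) = 1.
  by rewrite /y /Rpower -!exp_plus -[RHS]exp_0; congr exp; field.
have NE : N = y * y * (y * y) * (y * y * (y * y)).
  by rewrite /y -!exp_plus -[LHS]exp_ln //; congr exp; field.
set x := Rpower _ _ in yE *.
have x0 : 0 < x by apply: exp_pos.
have L0 : 0 <= ln D by rewrite -ln_1; apply: ln_le_mono; lra.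
have y1 : 1 <= y by apply: Rnot_lt_le => y1; nra.
(* From [ln D <= ln N = 8 ln y] and [ln y <= y - 1]. *)
have L_le : L <= 8 * y.
  have lnD : ln D <= ln N by apply: ln_le_mono; lra.
  have := exp_ineq1_le (ln N / 8); rewrite -/y /L; lra.
have x1 : x <= 1 by nra.
(* [ln (1 + x) >= x / (1 + x)], and the denominator is at most 2. *)
have lnx : x / 2 <= ln (1 + x).
  have x1' : 0 < 1 + x by lra.
  apply: Rle_trans (ln_ge_sub_inv x1').
  have -> : 1 - / (1 + x) = x * / (1 + x) by field; lra.
  by apply: Rmult_le_compat_l; [lra | apply: Rinv_le_contravar; lra].
apply: (Rle_trans _ (D * (x / 2))); last by apply: Rmult_le_compat_l; lra.
(* Here [D >= N / 2] enters, with [N * x = sqrt N = y^4]. *)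
have Dx : y * y * (y * y) / 4 <= D * (x / 2).
  have -> : y * y * (y * y) / 4 = N / 2 * (x / 2).
    by rewrite -[LHS]Rmult_1_r -yE [N]NE; field.
  by apply: Rmult_le_compat_r; lra.
apply: Rle_trans Dx.
have : L * L <= 64 * (y * y) by rewrite /L in L_le *; nra.
have : y <= y * y by nra.
nra.
Qed.

Lemma num_one_factorizations_asymptotic n d (g : rel 'I_n) :
  exp (4 * ln 288) <= INR n -> (n <= 2 * d)%nat -> simple_graph g -> regular d g ->
  INR (num_one_factorizations d g) <=
    Rpower ((1 + Rpower (INR n) (- (1 / 2))) * (INR d / exp 2)) (INR (d * n) / 2).
Proof.
move=> N_large nd sg rg.
have n_gt0 : (0 < n)%nat.
  by apply/ltP/INR_lt; have := exp_pos (4 * ln 288); rewrite /=; lra.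
have d_gt0 : (0 < d)%nat by move: n_gt0 nd; case: d {rg} => //; case: n {g sg N_large}.
(* A degree is at most the number of vertices; [error_term_le] uses this to bound [ln d] by
   [ln n]. *)
have dn : (d <= n)%nat.
  by rewrite -(rg (Ordinal n_gt0)) /deg (leq_trans (max_card _)) ?card_ord.
have Dpos := INR_gt0 d_gt0; have Npos := INR_gt0 n_gt0.
apply: Rle_trans (num_one_factorizations_le sg rg) _.
have err : 1 + ln (INR d) + (1 + ln (INR d)) * (1 + ln (INR d)) <=
    INR d * ln (1 + Rpower (INR n) (- (1 / 2))).
  apply: error_term_le => //; first exact: INR_leq d_gt0.
  by split; [have := INR_leq nd; rewrite mult_INR [INR 2]/=; lra | exact: INR_leq].
have x0 : 0 < Rpower (INR n) (- (1 / 2)) by apply: exp_pos.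
set x := Rpower (INR n) _ in err x0 *.
have le_d : \big[Rplus/0]_(k < d) wt k.+1 <= INR d * (ln (1 + x) + (ln (INR d) - 2)).
  by have := wt_sum_le d_gt0; lra.
have lnE : ln ((1 + x) * (INR d / exp 2)) = ln (1 + x) + (ln (INR d) - 2).
  have e2 := exp_pos 2.
  rewrite ln_mult; [|lra|exact: Rdiv_lt_0_compat].
  by rewrite /Rdiv ln_mult ?ln_Rinv ?ln_exp //; exact: Rinv_0_lt_compat.
rewrite [X in _ <= X]/Rpower lnE mult_INR; apply: exp_le.
apply: Rle_trans (Rmult_le_compat_l _ _ _ _ le_d) _; first lra.
apply: Req_le; field.
Qed.

Local Close Scope R_scope.

Theorem theorem10 :
  exists n0 : nat, forall (n d : nat) (g : rel 'I_n),
    (n0 <= n)%N -> ~~ odd n -> (n <= 2 * d)%N ->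
    simple_graph g -> regular d g ->
    (INR (num_one_factorizations d g) <=
       Rpower ((1 + Rpower (INR n) (- (1 / 2))) * (INR d / exp 2))
              (INR (d * n) / 2))%R.
Proof.
have [n0 n0_large] := INR_unbounded (exp (4 * ln 288)).
exists n0 => n d g n_large _; apply: num_one_factorizations_asymptotic.
exact/Rlt_le/(Rlt_le_trans _ _ _ n0_large)/INR_leq.
Qed.
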